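(* For every integer $B\ge 1$, the family of rectangular grid graphs is $(B,1)$-partitionable.
   Context: All graphs are finite; a rectangular grid graph is a $k\times\ell$ grid graph for positive integers $k,\ell$. A contiguous $q$-partition of a graph $G$ is a partition of $V(G)$ into $q$ (not necessarily nonempty) pieces (classes), each inducing a connected subgraph of $G$; it is $B$-bounded if every piece has size $\le B$. Two partitions agree except on a vertex set $W$ if their classes can be labelled so that each vertex outside $W$ has the same label in both. A family $\mathcal{G}$ of graphs is $(B,\alpha)$-partitionable if for every $\varepsilon>0$ there are $K$ and $\delta>0$ such that for every sufficiently large $G\in\mathcal{G}$, with $n=|V(G)|$, and every integer $q>(1+\varepsilon)n/(\alpha B)$: (1) there is a polynomial time algorithm to find a $B$-bounded contiguous $q$-partition of $G$; and (2) for any $B$-bounded contiguous partition $\omega$ of $G$ with exactly $q$ nonempty classes, there are at least $\delta|V(G)|$ distinct $B$-bounded contiguous partitions $\omega_i$ of $G$, each using fewer than $q$ nonempty classes, and each agreeing with $\omega$ except on (the vertex set of) a connected subgraph $H_i$ of $G$ with at most $K$ vertices. *)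

(* Defs.v *)
From mathcomp Require Import all_boot all_order all_algebra.
From mathcomp Require Import reals.

Set Implicit Arguments.
Unset Strict Implicit.
Unset Printing Implicit Defensive.

Import Order.TTheory GRing.Theory Num.Theory.

Record sgraph := SGraph {
  vertex :> finType;
  edge : rel vertex;
  edge_sym : symmetric edge;
  edge_irrefl : irreflexive edge }.

Definition isomorphic (G H : sgraph) : Prop :=
  exists2 f : G -> H, bijective f & forall u v, edge (f u) (f v) = edge u v.

Definition grid_edge (k l : nat) : rel ('I_k * 'I_l) :=
  fun u v =>
    (u.1 == v.1) && ((u.2.+1 == v.2 :> nat) || (v.2.+1 == u.2 :> nat)) ||
    (u.2 == v.2) && ((u.1.+1 == v.1 :> nat) || (v.1.+1 == u.1 :> nat)).

Lemma grid_edge_sym k l : symmetric (@grid_edge k l).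
Proof.
move=> u v; rewrite /grid_edge (eq_sym u.1) (eq_sym u.2).
by congr (_ && _ || _ && _); rewrite orbC.
Qed.

Lemma grid_edge_irrefl k l : irreflexive (@grid_edge k l).
Proof. by move=> u; rewrite /grid_edge !eqxx !gtn_eqF. Qed.

Definition grid (k l : nat) : sgraph :=
  SGraph (@grid_edge_sym k l) (@grid_edge_irrefl k l).

Definition rectangular_grid (G : sgraph) : Prop :=
  exists k l : nat, [/\ (0 < k)%N, (0 < l)%N & isomorphic G (grid k l)].

(* [A] induces a connected subgraph; the empty set qualifies, which is what is
   needed for empty classes of a q-partition. *)
Definition connected_set (G : sgraph) (A : {set G}) : Prop :=
  {in A &, forall u v,
     connect [rel x y | [&& x \in A, y \in A & edge x y]] u v}.

(* The classes are the fibres of [c]; some may be empty. *)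
Definition bounded_contiguous_qpartition (G : sgraph) (B q : nat)
    (c : {ffun G -> 'I_q}) : Prop :=
  forall t : 'I_q,
    connected_set [set v | c v == t] /\ (#|[set v | c v == t]| <= B)%N.

(* An unlabelled partition, given by its set of nonempty classes. *)
Definition bounded_contiguous_partition (G : sgraph) (B : nat)
    (P : {set {set G}}) : Prop :=
  partition P [set: G] /\
  {in P, forall A, connected_set A /\ (#|A| <= B)%N}.

Definition labels_classes (G : sgraph) (P : {set {set G}}) (f : G -> nat) :
    Prop :=
  forall u v, f u = f v <-> exists2 A, A \in P & (u \in A) /\ (v \in A).

Definition agree_except (G : sgraph) (W : {set G}) (P Q : {set {set G}}) :
    Prop :=
  exists f g : G -> nat,
    [/\ labels_classes P f, labels_classes Q g &
        forall v, v \notin W -> f v = g v].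

(* Algorithms are programs for a random access machine whose memory consists of
   arrays of natural numbers with indirect addressing; a program mentions only
   finitely many array names.  Arithmetic is addition and truncated subtraction
   at unit cost: without multiplication, the largest value at most doubles per
   operation, so polynomial time on this machine is polynomial
   time in the usual sense. *)
Definition store := nat -> nat -> nat.

Inductive expr :=
  | Const of nat
  | Read of nat & expr
  | Plus of expr & expr
  | Minus of expr & expr.

Fixpoint eval (s : store) (e : expr) : nat :=
  match e with
  | Const m => m
  | Read a e1 => s a (eval s e1)
  | Plus e1 e2 => eval s e1 + eval s e2
  | Minus e1 e2 => eval s e1 - eval s e2
  end.

Fixpoint cost (e : expr) : nat :=
  match e with
  | Const _ => 1
  | Read _ e1 => (cost e1).+1
  | Plus e1 e2 | Minus e1 e2 => (cost e1 + cost e2).+1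
  end.

Definition update (s : store) (a i x : nat) : store :=
  fun b j => if (b == a) && (j == i) then x else s b j.

Inductive cmd :=
  | Skip
  | Write of nat & expr & expr
  | Seq of cmd & cmd
  | If of expr & cmd & cmd
  | While of expr & cmd.

(* [exec p s t s']: started in [s], the program [p] halts after [t] time units
   in [s'].  Tests succeed on nonzero values. *)
Inductive exec : cmd -> store -> nat -> store -> Prop :=
  | exec_skip s : exec Skip s 1 s
  | exec_write s a e1 e2 :
      exec (Write a e1 e2) s (cost e1 + cost e2).+1
           (update s a (eval s e1) (eval s e2))
  | exec_seq s1 s2 s3 p1 p2 t1 t2 :
      exec p1 s1 t1 s2 -> exec p2 s2 t2 s3 -> exec (Seq p1 p2) s1 (t1 + t2) s3
  | exec_if_true s s' e p1 p2 t :
      eval s e <> 0 -> exec p1 s t s' -> exec (If e p1 p2) s (cost e + t) s'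
  | exec_if_false s s' e p1 p2 t :
      eval s e = 0 -> exec p2 s t s' -> exec (If e p1 p2) s (cost e + t) s'
  | exec_while_stop s e p :
      eval s e = 0 -> exec (While e p) s (cost e) s
  | exec_while_step s1 s2 s3 e p t1 t2 :
      eval s1 e <> 0 -> exec p s1 t1 s2 -> exec (While e p) s2 t2 s3 ->
      exec (While e p) s1 (cost e + t1 + t2) s3.

(* The input [(G, q)], for an arbitrary enumeration [x] of the vertices:
   cell 0 of array 0 holds n = |V(G)|, cell 0 of array 1 holds q, and array 2
   holds the n x n adjacency matrix row by row.  All other cells are 0. *)
Definition input (G : sgraph) (x : 'I_#|G| -> G) (q : nat) : store :=
  fun a m =>
    match a, m with
    | 0, 0 => #|G|
    | 1, 0 => q
    | 2, _ => [exists i : 'I_#|G|, exists j : 'I_#|G|,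
                (m == i * #|G| + j) && edge (x i) (x j)] : nat
    | _, _ => 0
    end.

(* Within [T] time units, [p] writes into array 3 the class labels of a
   B-bounded contiguous q-partition, cell [i] being the label of [x i]. *)
Definition finds_qpartition (p : cmd) (T B : nat) (G : sgraph)
    (x : 'I_#|G| -> G) (q : nat) : Prop :=
  exists (t : nat) (s : store) (c : {ffun G -> 'I_q}),
    [/\ exec p (input x q) t s, (t <= T)%N,
        bounded_contiguous_qpartition B c &
        forall i : 'I_#|G|, s 3 i = c (x i)].

(* The algorithm is one program serving all sufficiently large members of the
   family and all admissible q, running in time polynomial in n = |V(G)|. *)
Definition partitionable (R : realType) (F : sgraph -> Prop) (B : nat)
    (alpha : R) : Prop :=
  forall eps : R, (0 < eps)%R ->
  exists (K : nat) (delta : R) (N : nat),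
    let admissible (G : sgraph) (q : nat) :=
      [/\ F G, (N <= #|G|)%N &
          ((1 + eps) * #|G|%:R / (alpha * B%:R) < q%:R)%R] in
    [/\ (0 < delta)%R,
        exists (p : cmd) (C d : nat),
          forall (G : sgraph) (q : nat), admissible G q ->
          forall x : 'I_#|G| -> G, bijective x ->
          finds_qpartition p (C * #|G|.+1 ^ d) B x q
      & forall (G : sgraph) (q : nat), admissible G q ->
        forall P : {set {set G}},
          bounded_contiguous_partition B P -> #|P| = q ->
          exists2 S : {set {set {set G}}},
            (delta * #|G|%:R <= #|S|%:R)%R &
            {in S, forall Q,
              [/\ bounded_contiguous_partition B Q, (#|Q| < q)%N &
                  exists W : {set G},
                    [/\ connected_set W, (#|W| <= K)%N &
                        agree_except W P Q]]}].

(* Main.v *)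
(* Finding a partition: a walk that starts at a vertex of minimum degree and
   always moves to an unvisited neighbour with the fewest unvisited neighbours
   traverses a Hamiltonian path of a grid, since the unvisited part stays a
   rectangle, up to a segment of one side along which the walk is moving.
   Cutting this path every B vertices gives at most q classes as n < q B.

   Improving a partition: cut the grid into s x s tiles.  For a tile C, replace
   the classes that meet C by the length-B segments of a Hamiltonian path of C
   and singletons for the leftover vertices outside C.  Every class contained in
   no tile meets the tile borders, which have at most 2n/s vertices, so for
   large s all these new classes together number hardly more than n/B, and a
   linear number of tiles yields a decrease.  The results are distinct: where
   the count decreases, some old class inside C is destroyed, and this class
   survives the replacement at any other tile. *)

Require Import Defs.
From mathcomp Require Import all_boot all_order all_algebra.
From mathcomp Require Import reals.
From mathcomp Require Import zify lra.

Set Implicit Arguments.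
Unset Strict Implicit.
Unset Printing Implicit Defensive.

Import Order.TTheory GRing.Theory Num.Theory.

(** * Charts and the greedy walk *)

(** The formula of [grid_edge] on bare natural numbers, so that coordinates can be shifted and
    reflected freely. *)
Definition adjacent (c d : nat * nat) : bool :=
  (c.1 == d.1) && ((c.2.+1 == d.2) || (d.2.+1 == c.2)) ||
  (c.2 == d.2) && ((c.1.+1 == d.1) || (d.1.+1 == c.1)).

(* An a x b rectangle without the first m cells of its row 0. *)
Definition notched (a b m : nat) (c : nat * nat) : bool :=
  [&& c.1 < a, c.2 < b & (0 < c.1) || (m <= c.2)].

Section Greedy.
Variable G : sgraph.
Implicit Types (X Y U : {set G}) (u v w x : G) (phi : nat * nat -> G).

Definition degree_in U u := #|[set w in U | edge u w]|.

(** An isomorphism from a notched rectangle onto the subgraph induced by [X]; values of [phi] off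
    the rectangle are arbitrary. *)
Definition chart X a b m phi : Prop :=
  [/\ forall x, x \in X <-> exists2 c, notched a b m c & x = phi c,
      {in notched a b m &, injective phi} &
      {in notched a b m &, forall c d, edge (phi c) (phi d) = adjacent c d}].

(* By the last condition, a walk that is still running along row 0 has a
   rectangle of width more than two beside it. *)
Definition region X v : Prop :=
  exists a b m phi,
    [/\ chart X a b m phi, notched a b m (0, m), v = phi (0, m) &
        [\/ m = 0, 2 < a | m.+1 = b /\ 1 < a]].

Lemma chart_mem X a b m phi c :
  chart X a b m phi -> notched a b m c -> phi c \in X.
Proof. by case=> XE _ _ hc; apply/XE; exists c. Qed.

(** Here [h] changes coordinates and [h'] inverts it on the relevant cells. The symmetries and cell
    removals below are instances. *)
Lemma chart_reparam X Y a b m phi a' b' m' h h' :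
  chart X a b m phi -> Y \subset X ->
  (forall c, notched a' b' m' c ->
     [/\ notched a b m (h c), phi (h c) \in Y & h' (h c) = c]) ->
  (forall c, notched a b m c -> phi c \in Y ->
     notched a' b' m' (h' c) /\ h (h' c) = c) ->
  (forall c d, notched a' b' m' c -> notched a' b' m' d ->
     adjacent (h c) (h d) = adjacent c d) ->
  chart Y a' b' m' (phi \o h).
Proof.
move=> [XE injphi edgeE] /subsetP sYX hin hout hadj; split.
- move=> x; split=> [Yx | [c nc ->]]; last by case: (hin c nc).
  have /XE[c nc xE] := sYX _ Yx; rewrite xE in Yx.
  by have [nc' hc'] := hout c nc Yx; exists (h' c); rewrite //= hc'.
- move=> c d nc nd /= eq_phi.
  have [hc _ <-] := hin c nc; have [hd _ <-] := hin d nd.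
  by congr h'; apply: injphi.
- move=> c d nc nd /=; have [hc _ _] := hin c nc; have [hd _ _] := hin d nd.
  by rewrite edgeE // hadj.
Qed.

Lemma chart_transpose X a b phi :
  chart X a b 0 phi -> chart X b a 0 (fun c => phi (c.2, c.1)).
Proof.
move=> ch; apply: (chart_reparam (h := fun c => (c.2, c.1))
  (h' := fun c => (c.2, c.1)) ch) => //.
- case=> i j nc; have nc' : notched a b 0 (j, i).
    by move: nc; rewrite /notched /=; lia.
  by split=> //; apply: chart_mem ch _.
- by case=> i j nc _; split=> //; move: nc; rewrite /notched /=; lia.
- by move=> [i j] [i' j'] _ _; rewrite /adjacent /= orbC.
Qed.

Lemma chart_flip X a b phi :
  chart X a b 0 phi -> chart X a b 0 (fun c => phi (c.1, b.-1 - c.2)).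
Proof.
move=> ch; apply: (chart_reparam (h := fun c => (c.1, b.-1 - c.2))
  (h' := fun c => (c.1, b.-1 - c.2)) ch) => //.
- case=> i j; rewrite /notched /= => nc.
  have nc' : notched a b 0 (i, b.-1 - j) by rewrite /notched /=; lia.
  by split=> //; [apply: chart_mem ch _ | congr pair; lia].
- by case=> i j; rewrite /notched /= => nc _; split; [lia | congr pair; lia].
- by move=> [i j] [i' j']; rewrite /notched /adjacent /=; lia.
Qed.

Lemma chart_memD1 X a b m phi c d :
  chart X a b m phi -> notched a b m c -> notched a b m d ->
  (phi c \in X :\ phi d) = (c != d).
Proof.
move=> ch nc nd; rewrite !inE (chart_mem ch nc) andbT.
by case: ch => _ injphi _; rewrite (inj_in_eq injphi).
Qed.

(** The greedy comparisons need only degree bounds, certified by short explicit lists of cells: from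
    above here, from below in the next lemma. *)
Lemma degree_in_chart_le X a b m phi U c (s : seq (nat * nat)) :
  chart X a b m phi -> U \subset X -> notched a b m c ->
  (forall d, notched a b m d -> phi d \in U -> adjacent c d -> d \in s) ->
  degree_in U (phi c) <= size s.
Proof.
move=> [XE injphi edgeE] /subsetP sUX nc hs.
rewrite -(size_map phi); apply: leq_trans (card_size _).
apply/subset_leq_card/subsetP=> w; rewrite inE => /andP[Uw].
have /XE[d nd wE] := sUX _ Uw; rewrite wE edgeE // => adj.
by apply: map_f; apply: hs; rewrite // -wE.
Qed.

Lemma degree_in_chart_ge X a b m phi U c (s : seq (nat * nat)) :
  chart X a b m phi -> notched a b m c -> uniq s ->
  {in s, forall d, [/\ notched a b m d, phi d \in U & adjacent c d]} ->
  size s <= degree_in U (phi c).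
Proof.
move=> [XE injphi edgeE] nc us hs; rewrite -(size_map phi).
have/card_uniqP <- : uniq [seq phi i | i <- s].
  rewrite map_inj_in_uniq // => d e /hs[nd _ _] /hs[ne _ _].
  exact: injphi.
apply/subset_leq_card/subsetP=> w /mapP[d /hs[nd Ud adj] ->].
by rewrite inE Ud edgeE.
Qed.

(** If there is neither a cell to the right nor a cell below, the rectangle has one row, of which
    only the current cell is left. *)
Lemma region_next X v :
  region X v -> X != [set v] -> exists2 u, u \in X :\ v & edge v u.
Proof.
move=> [a [b [m [phi [ch n0 vE side]]]]] neX.
suff [d nd adj]: exists2 d, notched a b m d & adjacent (0, m) d.
  exists (phi d); rewrite vE.
    rewrite (chart_memD1 ch nd n0); apply: contraTneq adj => ->.
    by rewrite /adjacent /=; lia.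
  by case: ch => _ _ ->.
have [lt_mb|] := ltnP m.+1 b.
  by exists (0, m.+1); move: n0; rewrite /notched /adjacent /=; lia.
have [lt1a|] := ltnP 1 a.
  by exists (1, m); move: n0; rewrite /notched /adjacent /=; lia.
move=> ale ble; case/eqP: neX; apply/setP=> x; rewrite inE; apply/idP/eqP.
  case: ch => XE _ _ /XE[[i j] nc ->]; rewrite vE; congr phi; congr pair;
  by move: n0 nc; rewrite /notched /=; lia.
by move=> ->; rewrite vE; apply: chart_mem ch n0.
Qed.

(** A move along row 0 lengthens the notch by one or, in a one-row rectangle, drops the first
    column. *)
Lemma region_advance X a b m phi :
  chart X a b m phi -> notched a b m (0, m.+1) ->
  [\/ a = 1 /\ m = 0, 2 < a | m.+2 = b /\ 1 < a] ->
  region (X :\ phi (0, m)) (phi (0, m.+1)).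
Proof.
move=> ch n1 side.
have n0 : notched a b m (0, m) by move: n1; rewrite /notched /=; lia.
case: (ltnP 1 a) => [lt1a|le_a1].
  exists a, b, m.+1, (phi \o id); split=> //.
  - apply: (chart_reparam (h := id) (h' := id) ch) => //; first exact: subD1set.
      case=> i j nc.
      have nc' : notched a b m (i, j) by move: nc; rewrite /notched /=; lia.
      split=> //; rewrite (chart_memD1 ch) //.
      by move: nc; rewrite /notched xpair_eqE /=; lia.
    case=> i j nc; rewrite (chart_memD1 ch) // xpair_eqE => ne.
    by split=> //; move: nc ne; rewrite /notched /=; lia.
  - by move: n1; rewrite /notched /=; lia.
  - case: side => [[]|lt2a|]; [lia | exact: Or32 | exact: Or33].
have m0 : m = 0 by case: side => [[]|lt2a|[]] //; lia.
subst m; have a1 : a = 1 by move: n1; rewrite /notched /=; lia.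
subst a; exists 1, b.-1, 0, (phi \o (fun c => (c.1, c.2.+1))); split=> //.
- apply: (chart_reparam (h' := fun c => (c.1, c.2.-1)) ch) => //.
  + exact: subD1set.
  + case=> i j; rewrite /notched /= => nc.
    have nc' : notched 1 b 0 (i, j.+1) by rewrite /notched /=; lia.
    by split=> //; rewrite (chart_memD1 ch) // xpair_eqE; lia.
  + case=> i j nc; rewrite (chart_memD1 ch) // xpair_eqE => ne.
    by move: nc ne; rewrite /notched /= => nc ne; split; [|congr pair]; lia.
- by move: n1; rewrite /notched /=; lia.
- exact: Or31.
Qed.

(** At its far end row 0 is used up; what remains is a full rectangle with one row less, reflected
    so that the walk stands at its origin. *)
Lemma region_turn X a b m phi :
  chart X a b m phi -> notched a b m (1, m) -> m.+1 = b ->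
  region (X :\ phi (0, m)) (phi (1, m)).
Proof.
move=> ch n1 bE; exists a.-1, b, 0, (phi \o (fun c => (c.1.+1, m - c.2))).
have n0 : notched a b m (0, m) by move: n1; rewrite /notched /=; lia.
split.
- apply: (chart_reparam (h' := fun c => (c.1.-1, m - c.2)) ch) => //.
  + exact: subD1set.
  + case=> i j; rewrite /notched /= => nc.
    have nc' : notched a b m (i.+1, m - j) by rewrite /notched /=; lia.
    split=> //; last by congr pair; lia.
    by rewrite (chart_memD1 ch) // xpair_eqE; lia.
  + case=> i j nc; rewrite (chart_memD1 ch) // xpair_eqE => ne.
    by move: nc ne; rewrite /notched /= => nc ne; split; [|congr pair]; lia.
  + by move=> [i j] [i' j']; rewrite /notched /adjacent /=; lia.
- by move: n1; rewrite /notched /=; lia.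
- by rewrite /= subn0.
- exact: Or31.
Qed.

(* The preference for small degrees keeps the walk on the boundary: the
   alternative to going straight has three unvisited neighbours.  At a corner
   both directions are fine, except that the short side comes first in a strip
   of width two. *)
Lemma region_step X v u :
  region X v -> u \in X :\ v -> edge v u ->
  (forall w, w \in X :\ v -> edge v w ->
     degree_in (X :\ v) u <= degree_in (X :\ v) w) ->
  region (X :\ v) u.
Proof.
move=> [a [b [m [phi [ch n0 -> side]]]]] {v} Xu edge_u min_u.
have sub : X :\ phi (0, m) \subset X := subD1set _ _.
(* At a corner, transposing the chart exchanges the two directions, so one claim about moves along
   row 0 serves both. *)
have corner a' b' phi' : chart X a' b' 0 phi' -> phi' (0, 0) = phi (0, m) ->
    notched a' b' 0 (0, 1) -> u = phi' (0, 1) -> region (X :\ phi (0, m)) u.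
  move=> ch' eq0 n1 uE; rewrite uE -eq0; apply: (region_advance ch') => //.
  have [|lt2a] := leqP a' 2; last exact: Or32.
  case: (ltngtP a' 1) => [|lt1a le_a2|a1 _]; last 1 first.
  - exact: Or31.
  - by move: n1; rewrite /notched /=; lia.
  have a2 : a' = 2 by lia.
  subst a'; have [|lt2b] := leqP b' 2.
    by move=> le_b2; apply: Or33; move: n1; rewrite /notched /=; lia.
  have n00 : notched 2 b' 0 (0, 0) by move: n1; rewrite /notched /=; lia.
  have n10 : notched 2 b' 0 (1, 0) by move: n1; rewrite /notched /=; lia.
  (* In this strip [(1, 0)] has at most one unvisited neighbour and [(0, 1)] at least two, so
     minimality of [u] rules out the move along the long side. *)
  move: sub min_u; rewrite -eq0 uE => sub /(_ (phi' (1, 0))).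
  rewrite (chart_memD1 ch') //; case: (ch') => _ _ -> // /(_ isT isT).
  have : degree_in (X :\ phi' (0, 0)) (phi' (1, 0)) <= size [:: (1, 1)].
    apply: (degree_in_chart_le ch' sub n10 _) => -[i j] nc.
    rewrite (chart_memD1 ch') // mem_seq1 !xpair_eqE => ne.
    by move: nc ne; rewrite /notched /adjacent /=; lia.
  have : size [:: (0, 2); (1, 1)] <= degree_in (X :\ phi' (0, 0)) (phi' (0, 1)).
    apply: (degree_in_chart_ge ch' n1) => // d.
    rewrite !in_cons in_nil orbF => /orP[] /eqP->.
      have n2 : notched 2 b' 0 (0, 2) by rewrite /notched /=; lia.
      by split=> //; rewrite (chart_memD1 ch').
    have n2 : notched 2 b' 0 (1, 1) by rewrite /notched /=; lia.
    by split=> //; rewrite (chart_memD1 ch').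
  by rewrite /=; lia.
have [d nd uE] : exists2 d, notched a b m d & u = phi d.
  by case: (ch) => XE _ _; apply/XE; apply: (subsetP sub).
have adj : adjacent (0, m) d by case: (ch) edge_u => _ _ edgeE; rewrite uE edgeE.
have {adj} : d = (0, m.+1) \/ d = (1, m).
  case: d nd adj {uE} => i j; rewrite /notched /adjacent /= => nd adj.
  by case: i nd adj => [|i] nd adj; [left | right]; congr pair; lia.
have [m0 | m_gt0] := posnP m.
  subst m => -[] dE; rewrite dE in uE nd; first exact: (corner a b phi).
  apply: (corner b a _ (chart_transpose ch)) => //.
  by move: nd; rewrite /notched /=; lia.
case=> dE; rewrite dE in uE nd; rewrite uE.
  apply: (region_advance ch) => //; case: side => [|lt2a|[]]; first by lia.
    exact: Or32.
  by move: nd; rewrite /notched /=; lia.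
have [lt_mb|le_bm] := ltnP m.+1 b; last first.
  by apply: (region_turn ch) => //; move: nd; rewrite /notched /=; lia.
(* Turning before the end of the row contradicts minimality: [(0, m.+1)] has at most two unvisited
   neighbours, but [(1, m)] has three, where [0 < m] provides [(1, m.-1)] and [2 < a] provides
   [(2, m)]. *)
have lt2a : 2 < a by case: side => //; lia.
have n1 : notched a b m (0, m.+1) by rewrite /notched /=; lia.
move: min_u; rewrite uE => /(_ (phi (0, m.+1))).
rewrite (chart_memD1 ch) // xpair_eqE; case: (ch) => _ _ -> //.
rewrite /adjacent /= !eqxx gtn_eqF // => /(_ isT isT).
have : degree_in (X :\ phi (0, m)) (phi (0, m.+1))
       <= size [:: (0, m.+2); (1, m.+1)].
  apply: (degree_in_chart_le ch sub n1 _) => -[i j] nc.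
  rewrite (chart_memD1 ch) // !inE !xpair_eqE => ne.
  by move: nc ne; rewrite /notched /adjacent /=; lia.
have : size [:: (1, m.-1); (1, m.+1); (2, m)]
       <= degree_in (X :\ phi (0, m)) (phi (1, m)).
  apply: (degree_in_chart_ge ch nd) => [|d'].
    by rewrite /= !inE !xpair_eqE /=; lia.
  move=> d's; suff nd' : notched a b m d'.
    move: d's nd'; rewrite !in_cons in_nil orbF.
    by case/or3P=> /eqP-> nd'; rewrite (chart_memD1 ch) //;
      split=> //; rewrite ?xpair_eqE /adjacent /=; lia.
  move: d's; rewrite !in_cons in_nil orbF.
  by case/or3P=> /eqP->; rewrite /notched /=; lia.
by rewrite /=; lia.
Qed.

(** Induction on the size of [X]: any neighbour of minimal remaining degree leaves a region behind
    by [region_step]. *)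
Lemma region_path X v :
  region X v -> exists2 p : seq G, path (@edge G) v p & uniq (v :: p) /\ X =i v :: p.
Proof.
move En: #|X| => n; elim: n X v En => [|n IHn] X v cX rX.
  move/eqP: cX; rewrite cards_eq0 => /eqP X0.
  by case: rX => [a [b [m [phi [ch n0 _ _]]]]]; have := chart_mem ch n0; rewrite X0 inE.
have [-> | neX] := eqVneq X [set v].
  by exists [::] => //; split=> // x; rewrite !inE.
have Xv : v \in X.
  by case: rX => [a [b [m [phi [ch n0 -> _]]]]]; apply: chart_mem ch n0.
have [u0 Xu0 edge_u0] := region_next rX neX.
have P0 : (u0 \in X :\ v) && edge v u0 by rewrite Xu0.
case: (arg_minnP (P := fun u => (u \in X :\ v) && edge v u)
  (degree_in (X :\ v)) P0) => u /andP[Xu edge_u] min_u.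
have rX' : region (X :\ v) u.
  by apply: region_step => // w Xw edge_w; apply: min_u; rewrite Xw.
have cX' : #|X :\ v| = n by move: (cardsD1 v X); rewrite Xv; lia.
have [p path_p [uniq_p XE]] := IHn _ _ cX' rX'.
exists (u :: p); first by rewrite /= edge_u.
split; first by rewrite cons_uniq uniq_p andbT -XE !inE eqxx.
by move=> x; rewrite in_cons -XE !inE; case: eqP => // ->.
Qed.

(** Flips and transpositions carry each of the four corners to the origin. *)
Lemma chart_corner_region X a b phi c :
  chart X a b 0 phi -> notched a b 0 c ->
  (c.1 == 0) || (c.1 == a.-1) -> (c.2 == 0) || (c.2 == b.-1) ->
  region X (phi c).
Proof.
have base a' b' phi' : chart X a' b' 0 phi' -> notched a' b' 0 (0, 0) ->
    region X (phi' (0, 0)).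
  by move=> ch n0; exists a', b', 0, phi'; split=> //; apply: Or31.
case: c => i j ch nc /= /orP[]/eqP iE /orP[]/eqP jE; subst i j.
- exact: base ch nc.
- have := base _ _ _ (chart_flip ch); rewrite /= subn0; apply.
  by move: nc; rewrite /notched /=; lia.
- have := base _ _ _ (chart_flip (chart_transpose ch)); rewrite /= subn0; apply.
  by move: nc; rewrite /notched /=; lia.
- have := base _ _ _ (chart_flip (chart_transpose (chart_flip ch))).
  rewrite /= !subn0; apply.
  by move: nc; rewrite /notched /=; lia.
Qed.

(** A cell with neighbours on both sides in its row has larger degree than the corner [(0, 0)].
    Hence a vertex of minimum degree is in an extreme column and, by transposition, in an extreme
    row. *)
Lemma region_start X a b phi v :
  chart X a b 0 phi -> v \in X ->
  (forall w, w \in X -> degree_in X v <= degree_in X w) -> region X v.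
Proof.
move=> ch Xv min_v.
have side a' b' phi' i j : chart X a' b' 0 phi' -> notched a' b' 0 (i, j) ->
    v = phi' (i, j) -> 0 < j < b'.-1 -> False.
  move=> ch' nc vE lt_j.
  have n0 : notched a' b' 0 (0, 0) by move: nc; rewrite /notched /=; lia.
  move: (min_v _ (chart_mem ch' n0)); rewrite vE.
  have corner : degree_in X (phi' (0, 0)) <=
      size (if a' == 1 then [:: (0, 1)] else [:: (0, 1); (1, 0)]).
    apply: (degree_in_chart_le ch' (subxx _) n0 _) => -[i' j'] + _.
    by case: eqP => a'1; rewrite /notched /adjacent !inE !xpair_eqE /=; lia.
  (* The optional third cell is a vertical neighbour: below the cell in row 0, above it
     otherwise. *)
  pose s := [:: (i, j.-1), (i, j.+1) &
    if a' == 1 then [::] else [:: (if i == 0 then 1 else i.-1, j)]].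
  have : size s <= degree_in X (phi' (i, j)).
    apply: (degree_in_chart_ge ch' nc) => [|d].
      rewrite /s; case: (a' == 1); rewrite /= !inE !xpair_eqE /=; lia.
    move=> ds.
    have [nd adj] : notched a' b' 0 d /\ adjacent (i, j) d.
      move: d ds nc => [i' j']; rewrite /s.
      case: (a' =P 1); case: (i =P 0) => ? ? /=;
        rewrite !inE !xpair_eqE /notched /adjacent /=; lia.
    by split=> //; apply: chart_mem ch' nd.
  by move: corner; rewrite /s; case: (a' == 1) => /=; lia.
have [[i j] nc vE] : exists2 c, notched a b 0 c & v = phi c.
  by case: (ch) => XE _ _; apply/XE.
rewrite vE; apply: (chart_corner_region ch nc) => /=; apply: contraT => ne.
  case: (side b a _ j i (chart_transpose ch)); rewrite ?vE //;
    by move: nc ne; rewrite /notched /=; lia.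
case: (side a b _ i j ch nc); rewrite ?vE //.
by move: nc ne; rewrite /notched /=; lia.
Qed.
End Greedy.

(** * Replacing the classes that meet a tile *)

Section Connectivity.
Variable G : sgraph.
Implicit Types (A C W : {set G}) (p : seq G).

Definition induced A : rel G := [rel x y | [&& x \in A, y \in A & edge x y]].

Lemma connect_induced_sym A : connect_sym (induced A).
Proof.
by apply: sym_connect_sym => x y; rewrite /induced /= edge_sym andbCA andbA.
Qed.

Lemma connect_induced_mono A C u v :
  A \subset C -> connect (induced A) u v -> connect (induced C) u v.
Proof.
move=> /subsetP sAC; apply: connect_sub => x y /and3P[Ax Ay xy].
by apply: connect1; rewrite /induced /= !sAC.
Qed.

Lemma connected_set1 (v : G) : connected_set [set v].
Proof. by move=> x y /set1P-> /set1P->; apply: connect0. Qed.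

(** A path inside one member reaches [C], runs through [C], and enters any other member where that
    one meets [C]. *)
Lemma connected_set_cover C (T : {set {set G}}) :
  connected_set C -> C \subset cover T ->
  {in T, forall A, connected_set A /\ ~~ [disjoint A & C]} ->
  connected_set (cover T).
Proof.
move=> conC sCT hT.
have reach u : u \in cover T -> exists2 c, c \in C & connect (induced (cover T)) u c.
  move=> /bigcupP[A TA Au]; have [conA /pred0Pn[c /andP[Ac Cc]]] := hT A TA.
  by exists c => //; apply: connect_induced_mono (bigcup_sup A TA) (conA _ _ Au Ac).
move=> u v /reach[c Cc uc] /reach[d Cd vd].
apply: connect_trans uc _; rewrite -/(induced _) connect_induced_sym in vd.
by apply: connect_trans vd; apply: connect_induced_mono sCT (conC _ _ Cc Cd).
Qed.

(** Serves both for segments of a Hamiltonian path and, with the full range of positions, for a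
    whole tile. *)
Lemma connected_set_interval p lo hi :
  sorted (@edge G) p -> uniq p ->
  connected_set [set v in p | lo <= index v p < hi].
Proof.
move=> sp up; set A := [set v in p | _].
have nthA x i : lo <= i < hi -> i < size p -> nth x p i \in A.
  by move=> hi_i lt_i; rewrite inE mem_nth // index_uniq.
have main x i n : lo <= i -> i + n < hi -> i + n < size p ->
    connect (induced A) (nth x p i) (nth x p (i + n)).
  elim: n => [|n IHn] lo_i lt_hi lt_p; first by rewrite addn0 connect0.
  apply: (connect_trans (IHn _ _ _)); try lia.
  apply: connect1; rewrite /induced /= !nthA; try lia.
  by rewrite addnS; apply: (sortedP x sp); rewrite -addnS.
move=> u v; rewrite !inE => /andP[pu /andP[lo_u hi_u]] /andP[pv /andP[lo_v hi_v]].
have lt_u : index u p < size p by rewrite index_mem.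
have lt_v : index v p < size p by rewrite index_mem.
rewrite -(nth_index u pu) -(nth_index u pv).
case: (leqP (index u p) (index v p)) => le_uv.
  by rewrite -(subnKC le_uv); apply: main; rewrite ?subnKC.
rewrite -/(induced _) connect_induced_sym -(subnKC (ltnW le_uv)).
by apply: main; rewrite ?subnKC // ltnW.
Qed.

(** With the quotient as index, the segment number of a vertex is the label that the program writes
    for it. *)
Definition chunk B p t : {set G} := [set v in p | index v p %/ B == t].

Lemma chunkE B p t : 0 < B ->
  chunk B p t = [set v in p | t * B <= index v p < t.+1 * B].
Proof.
move=> B_gt0; apply/setP=> v; rewrite !inE; congr (_ && _).
by rewrite -leq_divRL // -ltn_divLR // ltnS eqn_leq andbC.
Qed.

Lemma connected_set_chunk B p t : 0 < B ->
  sorted (@edge G) p -> uniq p -> connected_set (chunk B p t).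
Proof. by move=> B_gt0 sp up; rewrite chunkE //; apply: connected_set_interval. Qed.

Lemma card_chunk_le B p t : 0 < B -> #|chunk B p t| <= B.
Proof.
move=> B_gt0; rewrite chunkE // cardE -[X in _ <= X](size_iota (t * B)).
rewrite -(size_map (fun v => index v p)); apply: uniq_leq_size.
  rewrite map_inj_in_uniq ?enum_uniq // => u v.
  rewrite !mem_enum !inE => /andP[pu _] /andP[pv _] eq_uv.
  by rewrite -(nth_index u pu) eq_uv nth_index.
move=> i /mapP[v]; rewrite mem_enum inE mem_iota => /andP[_ h] ->.
by rewrite mulSn addnC in h.
Qed.
End Connectivity.

Lemma partition_of_cells (T : finType) (Q : {set {set T}}) :
  set0 \notin Q -> (forall v, exists2 A, A \in Q & v \in A) ->
  (forall A A' v, A \in Q -> A' \in Q -> v \in A -> v \in A' -> A = A') ->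
  partition Q setT.
Proof.
move=> nQ0 exQ eqQ; apply/and3P; split=> //.
  apply/eqP/setP=> v; rewrite inE; apply/bigcupP.
  by have [A QA Av] := exQ v; exists A.
apply/trivIsetP=> A A' QA QA'; apply: contraNT => /pred0Pn[v /andP[Av A'v]].
by apply/eqP; apply: eqQ Av A'v.
Qed.

Section Improvement.
Variables (G : sgraph) (B : nat) (P : {set {set G}}).
Implicit Types (A : {set G}) (v : G).
Hypotheses (B_gt0 : 0 < B) (partP : bounded_contiguous_partition B P).

Lemma class_exists v : exists2 A, A \in P & v \in A.
Proof.
case: partP => /and3P[/eqP covP _ _] _.
by apply/bigcupP; rewrite -/(cover P) covP.
Qed.

Lemma class_unique A C v : A \in P -> C \in P -> v \in A -> v \in C -> A = C.
Proof.
case: partP => /and3P[_ tiP _] _ PA PC Av Cv.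
by rewrite -(def_pblock tiP PA Av) -(def_pblock tiP PC Cv).
Qed.

Lemma class_neq0 A : A \in P -> A != set0.
Proof. by case: partP => /and3P[_ _ nP0] _; apply: contraTneq => ->. Qed.

Lemma class_connected A : A \in P -> connected_set A.
Proof. by case: partP => _ hP /hP[]. Qed.

Lemma class_card A : A \in P -> #|A| <= B.
Proof. by case: partP => _ hP /hP[]. Qed.

(** Classes are disjoint, so picking a vertex of [S] from each of them is injective. *)
Lemma card_classes_le (T : {set {set G}}) (S : {set G}) :
  T \subset P -> {in T, forall A, ~~ [disjoint A & S]} -> #|T| <= #|S|.
Proof.
move=> /subsetP sTP meetS; pose f A := [pick v in A :&: S].
have fP A : A \in T -> exists2 v, f A = Some v & v \in A /\ v \in S.
  move=> /meetS/pred0Pn[w ASw]; rewrite /f.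
  case: pickP => [v | /(_ w)]; last by rewrite inE [_ && _]ASw.
  by rewrite inE => /andP[Av Sv]; exists v.
rewrite -(card_imset (mem S) Some_inj).
have <- : #|[set f A | A in T]| = #|T|.
  apply: card_in_imset => A A' TA TA'.
  have [v -> [Av _]] := fP A TA; have [v' -> [A'v' _]] := fP A' TA' => -[vE].
  by apply: (class_unique (sTP _ TA) (sTP _ TA') Av); rewrite vE.
apply/subset_leq_card/subsetP=> _ /imsetP[A TA ->].
by have [v -> [_ Sv]] := fP A TA; apply: imset_f.
Qed.

Section Replace.
Variables (C : {set G}) (p : seq G).
Hypotheses (sorted_p : sorted (@edge G) p) (uniq_p : uniq p) (pC : C =i p).

Definition touching : {set {set G}} := [set A in P | ~~ [disjoint A & C]].

(** The last chunk is empty when [B] divides the length of [p], hence the removal of [set0]. *)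
Definition chunks : {set {set G}} :=
  [set chunk B p t | t : 'I_(size p %/ B).+1] :\ set0.

Definition fragments : {set {set G}} :=
  [set [set v] | v in cover touching :\: C].

Definition replacement : {set {set G}} :=
  (P :\: touching) :|: chunks :|: fragments.

Lemma sub_cover_touching : C \subset cover touching.
Proof.
apply/subsetP=> v Cv; have [A PA Av] := class_exists v.
apply/bigcupP; exists A => //; rewrite inE PA; apply/pred0Pn.
by exists v; apply/andP.
Qed.

Lemma connected_tile : connected_set C.
Proof.
have -> : C = [set v in p | 0 <= index v p < size p].
  by apply/setP=> v; rewrite !inE pC /= index_mem andbb.
exact: connected_set_interval.
Qed.

Lemma connected_cover_touching : connected_set (cover touching).
Proof.
apply: (connected_set_cover connected_tile sub_cover_touching) => A.
by rewrite inE => /andP[PA tA]; split=> //; apply: class_connected.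
Qed.

(** The three kinds of new class live in disjoint zones: outside [cover touching], inside [C], and
    in between. Disjointness of the new classes and agreement with [P] are read off from the zone of
    [v]. *)
Lemma in_replacementP A v : A \in replacement -> v \in A ->
  [\/ [/\ A \in P, A \notin touching & v \notin cover touching],
     [/\ v \in C & A = chunk B p (index v p %/ B)] |
     [/\ v \in cover touching, v \notin C & A = [set v]]].
Proof.
move=> + Av; rewrite !in_setU in_setD => /orP[/orP[/andP[tA PA]|]|].
- apply: Or31; split=> //; apply/bigcupP=> -[A' tA' A'v].
  have PA' : A' \in P by move: tA'; rewrite inE => /andP[].
  by rewrite (class_unique PA PA' Av A'v) tA' in tA.
- move: Av => /[swap]; rewrite in_setD1 => /andP[_ /imsetP[t _ ->]].
  rewrite inE => /andP[pv /eqP tE]; apply: Or32.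
  by rewrite pC pv tE.
- move: Av => /[swap] /imsetP[w /setDP[tw Cw] ->] /set1P->.
  exact: Or33.
Qed.

Lemma replacement_exists v : exists2 A, A \in replacement & v \in A.
Proof.
have [tv|tv] := boolP (v \in cover touching); last first.
  have [A PA Av] := class_exists v; exists A => //.
  rewrite !in_setU in_setD PA andbT; apply/orP; left; apply/orP; left.
  by apply: contra tv => tA; apply/bigcupP; exists A.
have [Cv|Cv] := boolP (v \in C); last first.
  exists [set v]; last exact: set11.
  by rewrite !in_setU; apply/orP; right; apply: imset_f; rewrite inE Cv.
have pv : v \in p by rewrite -pC.
have cv : v \in chunk B p (index v p %/ B) by rewrite inE pv /=.
exists (chunk B p (index v p %/ B)) => //.
rewrite !in_setU; apply/orP; left; apply/orP; right.
rewrite in_setD1; apply/andP; split; first by apply/set0Pn; exists v.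
have lt_t : index v p %/ B < (size p %/ B).+1.
  by rewrite ltnS leq_div2r // index_size.
by apply/imsetP; exists (Ordinal lt_t).
Qed.

Lemma replacement_partition : bounded_contiguous_partition B replacement.
Proof.
split.
  apply: partition_of_cells replacement_exists _ => [|A A' v QA QA' Av A'v].
    rewrite !in_setU in_setD in_setD1 eqxx orbF !negb_or.
    apply/andP; split.
      by rewrite negb_and; apply/orP; right; apply/negP=> /class_neq0/eqP.
    by apply/imsetP=> -[v _ /setP/(_ v)]; rewrite !inE eqxx.
  case: (in_replacementP QA Av) => [[PA _ tv]|[Cv ->]|[tv Cv ->]];
  case: (in_replacementP QA' A'v) => [[PA' _ tv']|[Cv' ->]|[tv' Cv' ->]] //.
  - exact: class_unique PA PA' Av A'v.
  - by rewrite (subsetP sub_cover_touching) in tv.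
  - by rewrite tv' in tv.
  - by rewrite (subsetP sub_cover_touching) in tv'.
  - by rewrite Cv in Cv'.
  - by rewrite tv in tv'.
  - by rewrite Cv' in Cv.
move=> A; rewrite !in_setU in_setD => /orP[/orP[/andP[_ PA]|]|].
- by split; [apply: class_connected | apply: class_card].
- rewrite in_setD1 => /andP[_ /imsetP[t _ ->]].
  by split; [apply: connected_set_chunk | apply: card_chunk_le].
- move=> /imsetP[v _ ->].
  by split; [apply: connected_set1 | rewrite cards1].
Qed.

Lemma card_touching_le : #|touching| <= #|C|.
Proof.
apply: card_classes_le => [|A]; last by rewrite inE => /andP[].
by apply/subsetP=> A; rewrite inE => /andP[].
Qed.

Lemma card_replacement :
  #|replacement| + #|touching| <=
  #|P| + (size p %/ B).+1 + #|cover touching :\: C|.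
Proof.
have sTP : touching \subset P by apply/subsetP=> A; rewrite inE => /andP[].
have c1 : #|chunks| <= (size p %/ B).+1.
  rewrite -[X in _ <= X]card_ord; apply: leq_trans (leq_imset_card _ _).
  exact/subset_leq_card/subD1set.
have c2 : #|fragments| <= #|cover touching :\: C| by apply: leq_imset_card.
have c3 : #|P :\: touching| + #|touching| = #|P|.
  by rewrite addnC -(cardsID touching P) (setIidPr sTP).
have c4 : #|replacement| <= #|P :\: touching| + #|chunks| + #|fragments|.
  rewrite cardsU; apply: leq_trans (leq_subr _ _) _.
  by rewrite leq_add2r cardsU; apply: leq_subr.
by move: c1 c2 c3 c4; lia.
Qed.

(** The rank of a block among all subsets of [G] does not depend on the partition, so a class common
    to two partitions gets the same label in both. *)
Lemma labels_classes_pblock (Q : {set {set G}}) :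
  partition Q setT ->
  labels_classes Q (fun v => enum_rank (pblock Q v) : nat).
Proof.
move=> /and3P[/eqP covQ tiQ _] u v.
have inQ w : w \in cover Q by rewrite covQ.
split=> [/val_inj/enum_rank_inj eq_uv | [A QA [Au Av]]].
  exists (pblock Q u); first exact: pblock_mem.
  by rewrite {2}eq_uv !mem_pblock.
by rewrite !(def_pblock tiQ QA).
Qed.

Lemma agree_except_replacement : agree_except (cover touching) P replacement.
Proof.
have [partQ _] := replacement_partition; have [partP' _] := partP.
exists (fun v => nat_of_ord (enum_rank (pblock P v))),
       (fun v => nat_of_ord (enum_rank (pblock replacement v))).
split; try exact: labels_classes_pblock.
move=> v tv; congr (nat_of_ord (enum_rank _)).
have [A QA Av] := replacement_exists v.
case: (in_replacementP QA Av) => [[PA _ _]|[Cv _]|[tv' _ _]].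
- case/and3P: partQ partP' => _ tiQ _ /and3P[_ tiP _].
  by rewrite (def_pblock tiQ QA Av) (def_pblock tiP PA Av).
- by rewrite (subsetP sub_cover_touching) in tv.
- by rewrite tv' in tv.
Qed.

Hypothesis many : (size p %/ B).+1 + #|cover touching :\: C| < #|touching|.

Lemma card_replacement_lt : #|replacement| < #|P|.
Proof. by move: card_replacement many; lia. Qed.

(** Otherwise every old class inside [C] would be a chunk, while every other touching class uses up
    its own vertex of the overhang; together these are too few to satisfy [many]. *)
Lemma replacement_breaks :
  exists A, [/\ A \in P, A \subset C & A \notin replacement].
Proof.
pose inner := [set A in P | A \subset C].
suff: ~~ (inner \subset replacement).
  by case/subsetPn=> A; rewrite inE => /andP[PA sAC] nQA; exists A.
apply: contraL many => /subsetP sIQ; rewrite -leqNgt.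
have cI : #|inner| <= (size p %/ B).+1.
  rewrite -[X in _ <= X]card_ord -cardsT.
  apply: leq_trans (leq_imset_card (fun t : 'I_ _ => chunk B p t) _).
  apply/subset_leq_card/subsetP=> A IA; have QA := sIQ A IA.
  move: IA; rewrite inE => /andP[PA /subsetP sAC].
  have [v Av] := set0Pn _ (class_neq0 PA); have Cv := sAC v Av.
  case: (in_replacementP QA Av) => [[_ _]|[_ ->]|[_]].
  - by rewrite (subsetP sub_cover_touching).
  - have lt_t : index v p %/ B < (size p %/ B).+1.
      by rewrite ltnS leq_div2r // index_size.
    by apply/imsetP; exists (Ordinal lt_t).
  - by rewrite Cv.
have cO : #|touching :\: inner| <= #|cover touching :\: C|.
  apply: card_classes_le => [|A].
    by apply/subsetP=> A; rewrite !inE => /andP[_ /andP[]].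
  rewrite in_setD => /andP[nIA tA]; have := tA; rewrite inE => /andP[PA _].
  move: nIA; rewrite inE PA /= => /subsetPn[v Av nCv].
  apply/pred0Pn; exists v; rewrite /= Av !inE nCv.
  by apply/bigcupP; exists A.
rewrite -(cardsID inner touching) leq_add //.
exact: leq_trans (subset_leq_card (subsetIr _ _)) cI.
Qed.
End Replace.
End Improvement.

(** * Counting the tiles at which the replacement is an improvement *)

Section Tiling.
Variables (G : sgraph) (B M : nat) (P : {set {set G}}) (J : finType).
Variables (tau : G -> J) (p : J -> seq G) (D : {set G}).
Hypotheses (B_gt0 : 0 < B) (partP : bounded_contiguous_partition B P).

Let tile j : {set G} := [set v | tau v == j].

Hypothesis path_p :
  forall j, [/\ sorted (@edge G) (p j), uniq (p j) & tile j =i p j].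
Hypothesis card_tile : forall j, #|tile j| <= M.
Hypothesis cut : forall u v : G, edge u v -> tau u != tau v -> (u \in D) || (v \in D).

(** A path inside [A] avoids [D], whereas every edge between different tiles has an end in [D]. *)
Lemma uncut_class A u v : A \in P -> [disjoint A & D] ->
  u \in A -> v \in A -> tau u = tau v.
Proof.
move=> PA dAD Au Av; have := class_connected partP PA Au Av.
move/connectP=> [q + ->]; elim: q u {Au} => //= w q IHq u.
move=> /andP[/and3P[Au Aw uw] /IHq <-]; apply/eqP.
apply: contraT => /(cut uw).
by rewrite (disjointFr dAD Au) (disjointFr dAD Aw).
Qed.

(** Only classes that meet [D] overhang a tile. There are at most [#|D|] of them, each meeting at
    most [B] tiles and overhanging each by at most [B] vertices. *)
Lemma sum_overhang :
  \sum_j #|cover (touching P (tile j)) :\: tile j| <= B ^ 2 * #|D|.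
Proof.
have cover_le j : #|cover (touching P (tile j)) :\: tile j| <=
    \sum_(A in P | ~~ [disjoint A & tile j]) #|A :\: tile j|.
  have -> : \sum_(A in P | ~~ [disjoint A & tile j]) #|A :\: tile j| =
            \sum_(A in touching P (tile j)) #|A :\: tile j|.
    by apply: eq_bigl => A; rewrite inE.
  rewrite /cover; elim/big_rec2: _ => [|A n U _ IH]; first by rewrite set0D cards0.
  rewrite setDUl; apply: leq_trans (leq_add (leqnn #|A :\: tile j|) IH).
  by rewrite cardsU leq_subr.
apply: (leq_trans (n :=
  \sum_j \sum_(A in P | ~~ [disjoint A & tile j]) #|A :\: tile j|)).
  by apply: leq_sum => j _; apply: cover_le.
rewrite (exchange_big_dep (mem P)) /=; last by move=> j A _ /andP[].
have crossing : #|[set A in P | ~~ [disjoint A & D]]| <= #|D|.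
  apply: (card_classes_le partP) => [|A]; last by rewrite inE => /andP[].
  by apply/subsetP=> A; rewrite inE => /andP[].
apply: leq_trans (leq_mul (leqnn _) crossing).
rewrite -sum1_card big_distrr /= big_mkcond [leqRHS]big_mkcond /=.
apply: leq_sum => A _; rewrite inE; have [PA|//] := boolP (A \in P).
have [dAD|_] := boolP [disjoint A & D]; last first.
  have tiles_le : \sum_(j | ~~ [disjoint A & tile j]) 1 <= B.
    rewrite sum1_card; apply: leq_trans (class_card partP PA).
    apply: leq_trans (leq_imset_card tau A).
    apply/subset_leq_card/subsetP=> j /pred0Pn[v /andP[Av]].
    by rewrite /= inE => /eqP <-; apply: imset_f.
  rewrite /= muln1 expnS expn1; apply: leq_trans (leq_mul (leqnn B) tiles_le).
  rewrite big_distrr /=; apply: leq_sum => j _; rewrite muln1.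
  apply: leq_trans (class_card partP PA).
  by apply: subset_leq_card; apply: subsetDl.
rewrite big1 // => j /andP[_ /pred0Pn[u /andP[Au]]].
rewrite /= inE => /eqP uj; apply/eqP; rewrite cards_eq0 setD_eq0.
apply/subsetP=> v Av; rewrite inE -uj.
by rewrite (uncut_class PA dAD Au Av).
Qed.

Let overfull := [set j | (size (p j) %/ B).+1 +
  #|cover (touching P (tile j)) :\: tile j| < #|touching P (tile j)|].

Let improve j := replacement B P (tile j) (p j).

(** The old class destroyed at [j] lies inside tile [j], so it does not touch tile [j'] and is kept
    by [improve j']. *)
Lemma improve_inj : {in overfull &, injective improve}.
Proof.
move=> j j' good_j _ eq_jj'; apply/eqP; apply: contraT => ne_jj'.
have [sp up pE] := path_p j; rewrite inE in good_j.
have [A [PA sAj /negP[]]] := replacement_breaks partP pE good_j.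
rewrite -/(improve j) eq_jj' !in_setU in_setD PA andbT.
apply/orP; left; apply/orP; left; rewrite inE PA negbK.
apply/pred0P=> v /=; apply/negP=> /andP[/(subsetP sAj)].
by rewrite !inE => /eqP-> /eqP jj'; rewrite jj' eqxx in ne_jj'.
Qed.

(** Every class touches some tile. An overfull tile is touched by at most [M] classes; any other
    tile by at most its number of chunks plus its overhang. The factor [B] clears the division in
    the number of chunks. *)
Lemma card_classes_overfull :
  #|P| * B <= #|overfull| * (M * B) + #|G| + #|J| * B + B ^ 3 * #|D|.
Proof.
have count_touching : #|P| <= \sum_j #|touching P (tile j)|.
  under eq_bigr do rewrite -sum1_card.
  have -> : \sum_j \sum_(A in touching P (tile j)) 1 =
      \sum_j \sum_(A in P | ~~ [disjoint A & tile j]) 1.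
    by apply: eq_bigr => j _; apply: eq_bigl => A; rewrite inE.
  rewrite (exchange_big_dep (mem P)) /=; last by move=> j A _ /andP[].
  rewrite -sum1_card; apply: leq_sum => A PA.
  have [v Av] := set0Pn _ (class_neq0 partP PA).
  rewrite (bigD1 (tau v)) //= PA; apply/pred0Pn; exists v.
  by rewrite /= Av inE eqxx.
have size_p j : size (p j) = #|tile j|.
  by have [_ /card_uniqP <- pE] := path_p j; apply: eq_card => v; rewrite pE.
have sum_tiles : \sum_j size (p j) = #|G|.
  rewrite -sum1_card (partition_big tau predT) //=.
  by apply: eq_bigr => j _; rewrite size_p -sum1_card; apply: eq_bigl => v; rewrite inE.
have -> : #|overfull| * (M * B) = \sum_j (j \in overfull) * (M * B).
  by rewrite -big_distrl /= -sum1_card big_mkcond.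
have -> : #|J| * B = \sum_(j : J) B by rewrite sum_nat_const.
rewrite -sum_tiles -!big_split /=.
apply: leq_trans (leq_mul count_touching (leqnn B)) _.
(* One factor [B] joins the [B ^ 2] of [sum_overhang]; the remaining inequality is checked tile by
   tile. *)
apply: leq_trans (leq_add (leqnn _) (_ : B * _ <= _)); last first.
  by rewrite expnS -mulnA; apply: leq_mul (leqnn B) sum_overhang.
rewrite [B * _]big_distrr big_distrl -big_split /=; apply: leq_sum => j _.
rewrite inE; case: ltnP => [_|few].
  have := leq_mul (leq_trans (card_touching_le partP (tile j)) (card_tile j)) (leqnn B).
  by rewrite /=; lia.
have := leq_mul few (leqnn B); have := leq_trunc_div (size (p j)) B.
by rewrite /=; lia.
Qed.

Lemma tiling_improvements : exists2 S : {set {set {set G}}},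
    #|P| * B <= #|S| * (M * B) + #|G| + #|J| * B + B ^ 3 * #|D| &
    {in S, forall Q,
      [/\ bounded_contiguous_partition B Q, #|Q| < #|P| &
          exists W : {set G},
            [/\ connected_set W, #|W| <= M * B & agree_except W P Q]]}.
Proof.
exists [set improve j | j in overfull].
  by rewrite (card_in_imset improve_inj) card_classes_overfull.
move=> _ /imsetP[j good_j ->]; have [sp up pE] := path_p j.
rewrite inE in good_j; split.
- exact: replacement_partition.
- exact: card_replacement_lt.
exists (cover (touching P (tile j))); split.
- exact: (connected_cover_touching partP sp up pE).
- apply: leq_trans (leq_card_cover _) _.
  apply: leq_trans (_ : #|touching P (tile j)| * B <= _).
    rewrite -sum_nat_const; apply: leq_sum => A.
    by rewrite inE => /andP[PA _]; apply: (class_card partP PA).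
  by rewrite leq_mul // (leq_trans (card_touching_le partP _)).
- exact: agree_except_replacement.
Qed.
End Tiling.

(** * Tilings of grids *)

Section Grid.
Variables (G : sgraph) (k l : nat) (f : G -> grid k l).
Hypotheses (f_bij : bijective f)
  (f_edge : forall u v, edge (f u) (f v) = edge u v).

Lemma card_grid : #|G| = k * l.
Proof. by rewrite (bij_eq_card f_bij) card_prod !card_ord. Qed.

Definition box i0 j0 a b : {set G} :=
  [set v | (i0 <= (f v).1 < i0 + a) && (j0 <= (f v).2 < j0 + b)].

Lemma chart_box i0 j0 a b : 0 < a -> 0 < b -> i0 + a <= k -> j0 + b <= l ->
  exists phi, chart (box i0 j0 a b) a b 0 phi.
Proof.
move=> a_gt0 b_gt0 le_k le_l; have [g fK gK] := f_bij.
have k_gt0 : 0 < k by lia.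
have l_gt0 : 0 < l by lia.
(* Out of range, [insubd] returns row or column 0; on notched cells the shifted coordinates are in
   range. *)
pose at_ (c : nat * nat) : grid k l :=
  (insubd (Ordinal k_gt0) (i0 + c.1), insubd (Ordinal l_gt0) (j0 + c.2)).
have at1 c : notched a b 0 c -> (at_ c).1 = i0 + c.1 :> nat.
  by rewrite /notched => nc; rewrite val_insubd; case: ltnP => //; lia.
have at2 c : notched a b 0 c -> (at_ c).2 = j0 + c.2 :> nat.
  by rewrite /notched => nc; rewrite val_insubd; case: ltnP => //; lia.
exists (fun c => g (at_ c)); split.
- move=> v; rewrite inE; split=> [box_v | [c nc ->]]; last first.
    by rewrite gK at1 // at2 //; move: nc; rewrite /notched; lia.
  exists ((f v).1 - i0, (f v).2 - j0).
    by case: (f v) box_v => i j /=; rewrite /notched /=; lia.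
  apply: (can_inj fK); rewrite gK; case: (f v) box_v => i j /= box_v.
  by congr pair; apply/val_inj; rewrite val_insubd subnKC ?ltn_ord //; lia.
- move=> c d nc nd /(can_inj gK) eq_at.
  have := at1 c nc; have := at2 c nc; rewrite eq_at at1 // at2 //.
  by case: c d {nc nd eq_at} => [i j] [i' j'] /= *; congr pair; lia.
- move=> c d nc nd; rewrite -f_edge !gK /= /grid_edge /adjacent -!val_eqE /=.
  by rewrite !at1 // !at2 //; lia.
Qed.

Lemma box_path i0 j0 a b : i0 + a <= k -> j0 + b <= l ->
  exists p : seq G, [/\ sorted (@edge G) p, uniq p & box i0 j0 a b =i p].
Proof.
move=> le_k le_l; have [a0 | a_gt0] := posnP a.
  exists [::]; split=> // v; rewrite !inE a0 addn0.
  by apply/negbTE; case: (f v) => i j /=; lia.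
have [b0 | b_gt0] := posnP b.
  exists [::]; split=> // v; rewrite !inE b0 addn0.
  by apply/negbTE; case: (f v) => i j /=; lia.
have [phi ch] := chart_box a_gt0 b_gt0 le_k le_l.
have n00 : notched a b 0 (0, 0) by rewrite /notched /=; lia.
have [p path_p [uniq_p boxE]] := region_path (chart_corner_region ch n00 isT isT).
by exists (phi (0, 0) :: p).
Qed.

Variable s : nat.
Hypothesis s_gt0 : 0 < s.

(** Tile indices include the quotient itself, so the last row or column of tiles may be narrower
    than [s] or empty. *)
Let tau (v : G) : 'I_(k %/ s).+1 * 'I_(l %/ s).+1 :=
  (inord ((f v).1 %/ s), inord ((f v).2 %/ s)).

Lemma tau_eqE v j : (tau v == j) = ((f v).1 %/ s == j.1) && ((f v).2 %/ s == j.2).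
Proof.
case: j => j1 j2; rewrite xpair_eqE -!val_eqE /= !inordK // ltnS leq_div2r //;
  exact: ltnW.
Qed.

Lemma tile_path j :
  exists p : seq G,
    [/\ sorted (@edge G) p, uniq p & [set v | tau v == j] =i p].
Proof.
have le_k : j.1 * s + minn s (k - j.1 * s) <= k.
  by have := ltn_ord j.1; rewrite ltnS leq_divRL //; lia.
have le_l : j.2 * s + minn s (l - j.2 * s) <= l.
  by have := ltn_ord j.2; rewrite ltnS leq_divRL //; lia.
have [p [sp up pE]] := box_path le_k le_l; exists p; split=> // v.
rewrite -pE !inE tau_eqE.
have divE (i t m : nat) : i < m ->
    (i %/ s == t) = (t * s <= i < t * s + minn s (m - t * s)).
  by move=> lt_im; rewrite eqn_leq -ltnS ltn_divLR // leq_divRL // mulSn; lia.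
by rewrite (divE _ _ k) // (divE _ _ l).
Qed.

(** Within a tile the quotients by [s] are fixed, so the two remainders determine the vertex. *)
Lemma card_tile_le j : #|[set v | tau v == j]| <= s * s.
Proof.
pose h (v : G) : 'I_s * 'I_s :=
  (Ordinal (ltn_pmod (f v).1 s_gt0), Ordinal (ltn_pmod (f v).2 s_gt0)).
have <- : #|{: 'I_s * 'I_s}| = s * s by rewrite card_prod !card_ord.
have <- : #|h @: [set v | tau v == j]| = #|[set v | tau v == j]|.
  apply: card_in_imset => u v; rewrite !inE !tau_eqE.
  move=> /andP[/eqP u1 /eqP u2] /andP[/eqP v1 /eqP v2] [e1 e2].
  apply: (bij_inj f_bij); rewrite [f u]surjective_pairing [f v]surjective_pairing.
  by congr pair; apply: val_inj; rewrite /= [LHS](divn_eq _ s) [RHS](divn_eq _ s);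
    rewrite ?u1 ?u2 ?v1 ?v2 ?e1 ?e2.
exact: max_card.
Qed.

(** First lines of all tiles but the first one: one side of each border already meets every crossing
    edge, and leaving out 0 keeps the count at most [m / s]. *)
Let cuts m : {set 'I_m} := [set i : 'I_m | (0 < i) && (s %| i)].

Let seam : {set G} := [set v | ((f v).1 \in cuts k) || ((f v).2 \in cuts l)].

Lemma card_cuts m : #|cuts m| * s <= m.
Proof.
case: m => [|m].
  by rewrite [#|_|]eq_card0 // => -[].
have -> : #|cuts m.+1| = m %/ s.
  rewrite -sum1_card big_mkcond big_ord_recl inE /= add0n.
  rewrite divn_count_dvd big_add1 big_mkord; apply: eq_bigr => i _.
  by rewrite inE /=; case: (s %| _).
exact: leq_trans (leq_trunc_div _ _) (leqnSn m).
Qed.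

Lemma card_seam : #|seam| * s <= 2 * #|G|.
Proof.
have -> : #|seam| = #|setX (cuts k) setT :|: setX setT (cuts l)|.
  rewrite -(on_card_preimset (onW_bij _ f_bij)).
  by apply: eq_card => v; rewrite !inE !andbT.
rewrite card_grid; apply: leq_trans (leq_mul _ (leqnn s)) _.
  by rewrite cardsU; apply: leq_subr.
rewrite mulnDl !cardsX !cardsT !card_ord.
have := leq_mul (card_cuts k) (leqnn l); have := leq_mul (leqnn k) (card_cuts l).
by nia.
Qed.

(** The quotient by [s] changes from [i] to [i.+1] only if [s] divides [i.+1], so the end with the
    larger coordinate is in the seam. *)
Lemma seamP u v : edge u v -> tau u != tau v -> (u \in seam) || (v \in seam).
Proof.
have jump i j : i.+1 = j -> i %/ s != j %/ s -> (0 < j) && (s %| j).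
  by move=> <-; rewrite divnS //; case: (s %| _) => //; rewrite add0n eqxx.
have lt_div m (i : 'I_m) : i %/ s < (m %/ s).+1.
  by rewrite ltnS leq_div2r // ltnW.
rewrite -f_edge tau_eqE !inE /tau !inordK ?lt_div // negb_and.
case: (f u) (f v) => [i j] [i' j']; rewrite /= /grid_edge /= -!val_eqE /=.
case/orP=> /andP[/eqP -> /orP[] /eqP e]; rewrite eqxx ?orbF /= => ne.
- by rewrite (jump _ _ e ne) ?orbT.
- by rewrite eq_sym in ne; rewrite (jump _ _ e ne) ?orbT.
- by rewrite (jump _ _ e ne) ?orbT.
- by rewrite eq_sym in ne; rewrite (jump _ _ e ne) ?orbT.
Qed.

(** A side [k] of length at least [s] has at most [2 * k / s] tile indices, which gains the factor
    [s]; a shorter positive side has at most twice its length. The bound on [s * s] prevents both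
    sides from being short. *)
Lemma card_tiles : 0 < k -> 0 < l -> s * s <= #|G| ->
  #|{: 'I_(k %/ s).+1 * 'I_(l %/ s).+1}| * s <= 4 * #|G|.
Proof.
move=> k_gt0 l_gt0; rewrite card_grid card_prod !card_ord => le_ss.
have := leq_trunc_div k s; have := leq_trunc_div l s.
have := leq_div k s; have := leq_div l s.
case: (leqP s k) => [le_sk|lt_ks]; first by nia.
have le_sl : s <= l by nia.
by nia.
Qed.

(** After multiplication by [s], [card_tiles] accounts for the term [4 * B] and [card_seam] for
    [2 * B ^ 3]. *)
Lemma grid_improvements B P : 0 < B -> bounded_contiguous_partition B P ->
  0 < k -> 0 < l -> s * s <= #|G| ->
  exists2 S : {set {set {set G}}},
    s * (#|P| * B) <=
      s * (#|S| * (s * s * B) + #|G|) + (4 * B + 2 * B ^ 3) * #|G| &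
    {in S, forall Q,
      [/\ bounded_contiguous_partition B Q, #|Q| < #|P| &
          exists W : {set G},
            [/\ connected_set W, #|W| <= s * s * B & agree_except W P Q]]}.
Proof.
move=> B_gt0 partP k_gt0 l_gt0 le_ss.
have [p path_p] := fin_all_exists tile_path.
have [S cS hS] := tiling_improvements B_gt0 partP path_p card_tile_le seamP.
exists S => //; have h1 := card_tiles k_gt0 l_gt0 le_ss; have h2 := card_seam.
have e1 : s * (#|{: 'I_(k %/ s).+1 * 'I_(l %/ s).+1}| * B) <= 4 * B * #|G|.
  by have := leq_mul h1 (leqnn B); lia.
have e2 : s * (B ^ 3 * #|seam|) <= 2 * B ^ 3 * #|G|.
  by have := leq_mul h2 (leqnn (B ^ 3)); lia.
apply: leq_trans (leq_mul (leqnn s) cS) _.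
by rewrite !mulnDr mulnDl -!addnA !leq_add2l leq_add.
Qed.
End Grid.

(** * The program *)

(** A total-correctness triple with an upper bound on the running time. *)
Definition halts (c : cmd) (s : store) (T : nat) (Q : store -> Prop) : Prop :=
  exists t s', [/\ exec c s t s', t <= T & Q s'].

Lemma halts_le c s T T' Q : halts c s T Q -> T <= T' -> halts c s T' Q.
Proof.
move=> [t [s' [ex le_tT Qs']]] le_TT'; exists t, s'; split=> //.
exact: leq_trans le_TT'.
Qed.

Lemma halts_post c s T (Q Q' : store -> Prop) :
  halts c s T Q -> (forall s', Q s' -> Q' s') -> halts c s T Q'.
Proof. by move=> [t [s' [ex le_tT Qs']]] QQ'; exists t, s'; split; auto. Qed.

Lemma halts_skip s (Q : store -> Prop) : Q s -> halts Skip s 1 Q.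
Proof. by move=> Qs; exists 1, s; split=> //; apply: exec_skip. Qed.

Lemma halts_write s a e1 e2 (Q : store -> Prop) :
  Q (update s a (eval s e1) (eval s e2)) ->
  halts (Write a e1 e2) s (cost e1 + cost e2).+1 Q.
Proof. by move=> Qs; do 2!eexists; split; [apply: exec_write | |]. Qed.

Lemma halts_seq c1 c2 s T1 T2 Q :
  halts c1 s T1 (fun s' => halts c2 s' T2 Q) -> halts (Seq c1 c2) s (T1 + T2) Q.
Proof.
move=> [t1 [s1 [ex1 le1 [t2 [s2 [ex2 le2 Qs2]]]]]].
by exists (t1 + t2), s2; split; [apply: exec_seq ex1 ex2 | apply: leq_add |].
Qed.

Lemma halts_if e c1 c2 s T1 T2 Q :
  (0 < eval s e -> halts c1 s T1 Q) -> (eval s e = 0 -> halts c2 s T2 Q) ->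
  halts (If e c1 c2) s (cost e + (T1 + T2)) Q.
Proof.
move=> h1 h2; have [e0|e_gt0] := posnP (eval s e).
  have [t [s' [ex le_t Qs']]] := h2 e0; exists (cost e + t), s'.
  by split=> //; [apply: exec_if_false | lia].
have [t [s' [ex le_t Qs']]] := h1 e_gt0; exists (cost e + t), s'.
by split=> //; [apply: exec_if_true ex; lia | lia].
Qed.

(** The loops below run a known number of rounds, so indexing the invariant by the round replaces a
    termination measure. *)
Lemma halts_while e c s T n (I : nat -> store -> Prop) :
  I 0 s ->
  (forall i s', i < n -> I i s' -> 0 < eval s' e /\ halts c s' T (I i.+1)) ->
  (forall s', I n s' -> eval s' e = 0) ->
  halts (While e c) s (n * (cost e + T) + cost e) (I n).
Proof.
move=> I0 step stop.
suff main m i s' : i + m = n -> I i s' ->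
    halts (While e c) s' (m * (cost e + T) + cost e) (I n) by apply: (main n 0).
elim: m i s' => [|m IHm] i s' def_n Is'.
  rewrite addn0 in def_n; subst i.
  by exists (cost e), s'; split=> //; apply: exec_while_stop; apply: stop.
have [|e_gt0 [t1 [s1 [ex1 le1 Is1]]]] := step i s' _ Is'; first by lia.
have [|t2 [s2 [ex2 le2 Is2]]] := IHm i.+1 s1 _ Is1; first by lia.
exists (cost e + t1 + t2), s2; split=> //; last by lia.
by apply: exec_while_step ex1 ex2; lia.
Qed.

Notation "'var' k" := (Read 5 (Const k)) (at level 10, k at level 9).
Notation "k <~ e" := (Write 5 (Const k) e) (at level 60).
Notation order_var := (Read 0 (Const 0)).
Infix ";;" := Seq (at level 65, right associativity).

(* Array 4 marks the visited vertices and array 5 holds the registers: 0 the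
   number of visited vertices, 1 the scanned vertex u, 2 the start u * n of its
   row, 3 and 4 the counter and the result of [count_cmd], 5, 6 and 7 the best
   candidate's degree, index and row, 8 the current row, 9 the size of the class
   being filled, 10 its label. *)
Definition count_cmd : cmd :=
  4 <~ Const 0 ;; 3 <~ Const 0 ;;
  While (Minus order_var (var 3))
    (4 <~ Plus (var 4) (Minus (Read 2 (Plus (var 2) (var 3))) (Read 4 (var 3))) ;;
     3 <~ Plus (var 3) (Const 1)).

(* Positive iff u is unvisited and follows the current vertex; the term
   [1 - var 0] admits every vertex at the first step. *)
Definition candidate_expr : expr :=
  Minus (Plus (Read 2 (Plus (var 8) (var 1))) (Minus (Const 1) (var 0)))
        (Plus (Read 4 (var 1)) (Read 4 (var 1))).

Definition scan_cmd : cmd :=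
  If candidate_expr
    (count_cmd ;;
     If (Minus (var 5) (var 4)) (5 <~ var 4 ;; 6 <~ var 1 ;; 7 <~ var 2) Skip)
    Skip ;;
  1 <~ Plus (var 1) (Const 1) ;;
  2 <~ Plus (var 2) order_var.

(** The initial best degree [n + 1] is a sentinel above every possible number of unvisited
    neighbours. *)
Definition choose_cmd : cmd :=
  5 <~ Plus order_var (Const 1) ;; 1 <~ Const 0 ;; 2 <~ Const 0 ;;
  While (Minus order_var (var 1)) scan_cmd.

(** Registers 9 and 10 follow the remainder and the quotient of the walk length by [B] through
    counting, as the machine has no division. *)
Definition step_cmd (B : nat) : cmd :=
  choose_cmd ;;
  Write 4 (var 6) (Const 1) ;;
  Write 3 (var 6) (var 10) ;;
  8 <~ var 7 ;;
  9 <~ Plus (var 9) (Const 1) ;;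
  If (Minus (Const B) (var 9)) Skip
     (9 <~ Const 0 ;; 10 <~ Plus (var 10) (Const 1)) ;;
  0 <~ Plus (var 0) (Const 1).

Definition walk_cmd (B : nat) : cmd :=
  While (Minus order_var (var 0)) (step_cmd B).

(** The frame condition: at most the registers in [K] have changed. *)
Definition same (K : seq nat) (s s' : store) : Prop :=
  forall a j, ~~ ((a == 5) && (j \in K)) -> s' a j = s a j.

(** On 0/1 entries the truncated difference is the indicator of an unvisited neighbour. *)
Definition weight (n : nat) (s : store) (b : nat) : nat :=
  \sum_(0 <= j < n) (s 2 (b + j) - s 4 j).

Definition candidate (s : store) (u : nat) : bool :=
  0 < s 2 (s 5 8 + u) + (1 - s 5 0) - (s 4 u + s 4 u).

Lemma same_update K s s' k m : same K s s' -> k \in K -> same K s (update s' 5 k m).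
Proof.
move=> sm kK a j nK; rewrite -(sm a j nK) /update.
by case: eqP nK => //= _; case: eqP => // ->; rewrite kK.
Qed.

Lemma same_trans K K' s s' s'' :
  {subset K <= K'} -> same K' s s' -> same K s' s'' -> same K' s s''.
Proof.
move=> sKK' sm sm' a j nK; rewrite -(sm a j nK); apply: sm'.
by apply: contra nK => /andP[-> /sKK'].
Qed.

Lemma eq_weight n s s' b K : same K s s' -> weight n s' b = weight n s b.
Proof. by move=> sm; apply: eq_bigr => j _; rewrite !sm. Qed.

Lemma halts_count n s : s 0 0 = n ->
  halts count_cmd s (40 * n + 20)
    (fun s' => s' 5 4 = weight n s (s 5 2) /\ same [:: 3; 4] s s').
Proof.
move=> s00; eapply halts_le.
  do 2!(apply: halts_seq; apply: halts_write => /=).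
  apply: halts_post.
    apply: (halts_while (n := n) (I := fun w s' =>
      [/\ s' 5 3 = w, s' 5 4 = \sum_(0 <= j < w) (s 2 (s 5 2 + j) - s 4 j) &
          same [:: 3; 4] s s'])).
    - split=> //; first by rewrite big_geq.
      by do 2!apply: same_update => //.
    - move=> w s' lt_wn [s3 s4 sm]; split.
        by rewrite /= s3 sm // s00 subn_gt0.
      apply: halts_seq; apply: halts_write; apply: halts_write => /=.
      split.
      + by rewrite /update /= s3 addn1.
      + by rewrite /update /= big_nat_recr //= s4 s3 !sm.
      + by do 2!apply: same_update => //.
    - by move=> s' [s3 _ sm]; rewrite /= s3 sm // s00 subnn.
  by move=> s' [_ s4 sm]; split.
by rewrite /=; lia.
Qed.

Definition best (n : nat) (s s' : store) (w : nat) : Prop :=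
  (forall u, u < w -> candidate s u -> s' 5 5 <= weight n s (u * n)) /\
  (s' 5 5 = n.+1 \/
   [/\ s' 5 6 < n, candidate s (s' 5 6), s' 5 5 = weight n s (s' 5 6 * n) &
       s' 5 7 = s' 5 6 * n]).

Lemma halts_choose n s : s 0 0 = n ->
  (exists u, [/\ u < n, candidate s u & weight n s (u * n) <= n]) ->
  halts choose_cmd s (100 * (n.+1 * n.+1))
    (fun s' => [/\ same [:: 1; 2; 3; 4; 5; 6; 7] s s', s' 5 6 < n,
       candidate s (s' 5 6) /\ s' 5 7 = s' 5 6 * n &
       forall u, u < n -> candidate s u ->
         weight n s (s' 5 6 * n) <= weight n s (u * n)]).
Proof.
move=> s00 [u0 [lt_u0 cand_u0 le_u0]]; set K := [:: _; _; _; _; _; _; _].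
have eqK s' : same K s s' -> s' 0 0 = n by move=> ->.
eapply halts_le.
  do 3!(apply: halts_seq; apply: halts_write => /=).
  apply: halts_post.
    apply: (halts_while (n := n) (I := fun w s' =>
      [/\ s' 5 1 = w, s' 5 2 = w * n, same K s s' & best n s s' w])).
    - split=> //; first by do 3!apply: same_update => //.
      by split=> //; left; rewrite /update /= s00 addn1.
    - move=> w s' lt_wn [s1 s2 sm bst]; split.
        by rewrite /= s1 eqK // subn_gt0.
      rewrite /scan_cmd; apply: halts_seq.
      apply: (halts_post (Q := fun s'' =>
        [/\ s'' 5 1 = w, s'' 5 2 = w * n, same K s s'' & best n s s'' w.+1])).
        have candE : eval s' candidate_expr =
            s 2 (s 5 8 + w) + (1 - s 5 0) - (s 4 w + s 4 w).
          by rewrite /= s1 !sm.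
        apply: halts_if => [cand_w|ncand_w]; last first.
          apply: halts_skip; split=> //; case: bst => bst1 bst2; split=> // u.
          rewrite ltnS leq_eqVlt => /orP[/eqP->|]; last exact: bst1.
          by rewrite /candidate -candE ncand_w.
        have {}cand_w : candidate s w by rewrite /candidate -candE.
        apply: halts_seq; apply: halts_post; first by apply: (halts_count (eqK _ sm)).
        move=> s'' [c4 sm4]; have sm'' : same K s s''.
          by apply: same_trans sm sm4 => k; rewrite !inE => /orP[] ->; rewrite !orbT.
        have e1 : s'' 5 1 = w by rewrite sm4.
        have e2 : s'' 5 2 = w * n by rewrite sm4.
        have e4 : s'' 5 4 = weight n s (w * n) by rewrite c4 s2 (eq_weight _ _ sm).
        have [e5 e6 e7] : [/\ s'' 5 5 = s' 5 5, s'' 5 6 = s' 5 6 & s'' 5 7 = s' 5 7].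
          by rewrite !sm4.
        case: bst => bst1 bst2; apply: halts_if => /= [lt45|ge45].
          do 2!(apply: halts_seq; apply: halts_write); apply: halts_write.
          rewrite /=; split=> //; first by do 3!apply: same_update => //.
          rewrite /update /best /= e1 e2 e4; split; last by right.
          move=> u; rewrite ltnS leq_eqVlt => /orP[/eqP-> //|lt_u cand_u].
          apply: leq_trans (bst1 u lt_u cand_u).
          by move: lt45; rewrite e4 e5 subn_gt0 => /ltnW.
        apply: halts_skip; split=> //; rewrite /best e5 e6 e7; split=> // u.
        rewrite ltnS leq_eqVlt => /orP[/eqP-> _|]; last exact: bst1.
        by rewrite -e5 -e4 -subn_eq0; apply/eqP.
      move=> s'' [e1 e2 sm'' bst'']; apply: halts_seq; do 2!apply: halts_write.
      rewrite /=; split.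
      + by rewrite /update /= e1 addn1.
      + by rewrite /update /= e2 eqK // mulSn addnC.
      + by do 2!apply: same_update => //.
      + by [].
    - by move=> s' [s1 _ sm _]; rewrite /= s1 eqK // subnn.
  move=> s' [_ _ sm [bst1 bst2]].
  have [s6 cand6 s5 s7] : [/\ s' 5 6 < n, candidate s (s' 5 6),
      s' 5 5 = weight n s (s' 5 6 * n) & s' 5 7 = s' 5 6 * n].
    (* The sentinel [n.+1] cannot survive the scan, since the candidate [u0] has weight at most
       [n]. *)
    case: bst2 => // s5; have := bst1 u0 lt_u0 cand_u0.
    by rewrite s5 => /leq_trans/(_ le_u0); rewrite ltnn.
  by split=> // u lt_u cand_u; rewrite -s5; apply: bst1.
rewrite /=; lia.
Qed.

(** * Correctness and running time of the walk *)

Section Walk.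
Variables (G : sgraph) (x : 'I_#|G| -> G).
Hypothesis x_bij : bijective x.
Hypothesis full_chart : exists a b phi, @chart G setT a b 0 phi.

Local Notation n := #|G|.
Implicit Types (p q : seq G) (s : store).

Definition front p v : bool :=
  (v \notin p) && (if p is z :: r then edge (last z r) v else true).

(** The region is the complement of the earlier vertices only, so it still contains the current
    vertex [y]. *)
Definition trail p : Prop :=
  [/\ uniq p, sorted (@edge G) p &
      forall q y, p = rcons q y -> region (~: [set v in q]) y].

Lemma front_rcons q y v :
  front (rcons q y) v = (v \in (~: [set w in q]) :\ y) && edge y v.
Proof.
rewrite /front !inE mem_rcons inE negb_or; congr (_ && _).
by case: q => //= z q; rewrite last_rcons.
Qed.

Lemma setC_rcons q y : ~: [set w in rcons q y] = (~: [set w in q]) :\ y.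
Proof. by apply/setP=> v; rewrite !inE mem_rcons inE negb_or. Qed.

(** The first vertex is handled by [region_start], every later one by [region_step]. *)
Lemma trail_step p u :
  trail p -> front p u ->
  (forall v, front p v ->
     degree_in (~: [set w in p]) u <= degree_in (~: [set w in p]) v) ->
  trail (rcons p u).
Proof.
move=> [up sp rp] front_u min_u; split.
- by rewrite rcons_uniq up andbT; case/andP: front_u.
- by case: p front_u sp {up rp min_u} => //= z r /andP[_ e] sp; rewrite rcons_path sp.
move=> q y /rcons_inj[<- <-] {q y}; case/lastP: p up sp rp front_u min_u.
  move=> _ _ _ _; have -> : ~: [set w in [::]] = [set: G].
    by apply/setP=> v; rewrite !inE.
  move=> min_u; have [a [b [phi ch]]] := full_chart.
  by apply: (region_start ch) => // w _; apply: min_u.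
move=> q y _ _ /(_ q y erefl) rq; rewrite front_rcons setC_rcons => /andP[Xu yu].
move=> min_u; apply: region_step => // w Xw yw; apply: min_u.
by rewrite front_rcons Xw.
Qed.

Lemma trail_front p : trail p -> size p < n -> exists u, front p u.
Proof.
move=> [up _ rp] lt_p; case/lastP: p up rp lt_p => [_ _|q y].
  by move=> /card_gt0P[u _]; exists u.
move=> up /(_ q y erefl) rq lt_p.
have [|u Xu yu] := region_next rq; last by exists u; rewrite front_rcons Xu.
apply: contraTneq lt_p => /(congr1 (fun X : {set G} => #|X|)).
rewrite cards1 cardsCs setCK size_rcons -leqNgt.
have -> : #|[set v in q]| = size q.
  rewrite cardsE; apply/card_uniqP.
  by move: up; rewrite rcons_uniq => /andP[].
by lia.
Qed.

Variable B : nat.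
Hypothesis B_gt0 : 0 < B.

Definition tracks p s : Prop :=
  [/\ s 0 0 = n /\ (forall i j : 'I_n, s 2 (i * n + j) = edge (x i) (x j)),
      forall j : 'I_n, s 4 j = (x j \in p),
      forall j : 'I_n, x j \in p -> s 3 j = index (x j) p %/ B,
      [/\ s 5 0 = size p, s 5 9 = size p %% B & s 5 10 = size p %/ B] &
      forall q y, p = rcons q y -> exists c : 'I_n, x c = y /\ s 5 8 = c * n].

Lemma tracks_candidate p s (u : 'I_n) :
  tracks p s -> candidate s u = front p (x u).
Proof.
move=> [[_ adj] vis _ [s0 _ _] cur]; rewrite /candidate vis s0.
case/lastP: p vis s0 cur => [|q y] vis s0 cur.
  by rewrite /front in_nil /= subn0 addn1.
have [c [xc ->]] := cur q y erefl; rewrite adj front_rcons xc size_rcons.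
rewrite -setC_rcons !inE.
by case: (edge _ _) (_ \in _) => [] [].
Qed.

Lemma tracks_weight p s (u : 'I_n) :
  tracks p s -> weight n s (u * n) = degree_in (~: [set w in p]) (x u).
Proof.
move=> [[_ adj] vis _ _ _]; rewrite /weight big_mkord /degree_in -sum1_card.
rewrite [RHS](reindex x) /=; last exact: onW_bij.
rewrite [RHS]big_mkcond /=; apply: eq_bigr => j _; rewrite adj vis !inE.
by case: (edge _ _) (_ \in _) => [] [].
Qed.

Lemma halts_step p s : trail p -> tracks p s -> size p < n ->
  halts (step_cmd B) s (100 * (n.+1 * n.+1) + 100)
    (fun s' => exists2 u, trail (rcons p u) & tracks (rcons p u) s').
Proof.
move=> tp trk lt_p; have [inv_x xK invK] := x_bij.
have [[s00 adj] vis lab [s0 s9 s10] cur] := trk.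
eapply halts_le.
  apply: halts_seq; apply: halts_post; first apply: (halts_choose s00).
    have [u fu] := trail_front tp lt_p; exists (inv_x u); split=> //.
      by rewrite (tracks_candidate _ trk) invK.
    by rewrite (tracks_weight _ trk); apply: max_card.
  move=> s1 [sm lt_u [cand_u s17] min_u].
  pose u := Ordinal lt_u; have uE : s1 5 6 = u by [].
  rewrite uE in cand_u s17 min_u.
  have fu : front p (x u) by rewrite -(tracks_candidate _ trk).
  have np : x u \notin p by case/andP: fu.
  have s19 : s1 5 9 = size p %% B by rewrite sm.
  have s1_10 : s1 5 10 = size p %/ B by rewrite sm.
  have s10' : s1 5 0 = size p by rewrite sm.
  do 4!(apply: halts_seq; apply: halts_write).
  apply: halts_seq; apply: halts_post.
    (* One postcondition for both branches: registers 9 and 10 hold remainder and quotient of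
       [(size p).+1] by [B], and outside array 5 only the mark and the label of [u] are new. *)
    apply: (halts_if (Q := fun s' =>
      [/\ forall a j, a != 5 -> s' a j =
            if (a == 4) && (j == u) then 1 else
            if (a == 3) && (j == u) then size p %/ B else s a j,
          s' 5 0 = size p, s' 5 8 = u * n, s' 5 9 = (size p).+1 %% B &
          s' 5 10 = (size p).+1 %/ B])).
      rewrite /= /update /= uE s17 s19 s1_10 subn_gt0 addn1 => lt_B.
      apply: halts_skip.
      have pE : (size p).+1 = size p %/ B * B + (size p %% B).+1.
        by rewrite addnS -divn_eq.
      split=> //.
      + move=> a j a5; rewrite (negbTE a5) /=.
        by case: (a =P 3) => [->|a3] /=; rewrite (sm _ j) ?(negbTE a5).
      + by rewrite /= pE modnMDl (modn_small lt_B).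
      + by rewrite /= pE divnMDl // (divn_small lt_B) addn0.
    rewrite /= /update /= uE s17 s19 s1_10 addn1 => /eqP ge_B.
    apply: halts_seq; do 2!apply: halts_write; rewrite /= /update /=.
    have pE : (size p).+1 = (size p %/ B).+1 * B.
      rewrite mulSn addnC {1}(divn_eq (size p) B) -addnS; congr (_ + _).
      by apply/eqP; rewrite eqn_leq ltn_pmod.
    split=> //.
    + move=> a j a5; rewrite (negbTE a5) /=.
      by case: (a =P 3) => [->|a3] /=; rewrite (sm _ j) ?(negbTE a5).
    + by rewrite /= pE modnMl.
    + by rewrite /= s1_10 pE mulnK // addn1.
  move=> s2 [s2E s20 s28 s29 s2_10]; apply: halts_write => /=.
  exists (x u).
    apply: trail_step => // v; rewrite -(invK v) -(tracks_candidate _ trk).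
    by move=> cand_v; rewrite -!(tracks_weight _ trk) min_u.
  split.
  - split; first by rewrite /update /= s2E.
    by move=> i j; rewrite /update /= s2E //= adj.
  - move=> j; rewrite /update /= s2E //= vis mem_rcons inE.
    rewrite (inj_eq (bij_inj x_bij)) -val_eqE /=.
    by case: eqP.
  - move=> j; rewrite /update /= s2E //= mem_rcons inE -cats1 index_cat.
    rewrite (inj_eq (bij_inj x_bij)) -val_eqE /=; case: eqP => [eq_ju|ne_ju].
      have -> : j = u by apply: val_inj.
      by rewrite (negbTE np) /= eqxx addn0.
    by move=> /= pj; rewrite pj lab.
  - by rewrite /update /= size_rcons s20 s29 s2_10 addn1.
  - move=> q y /rcons_inj[_ <-]; exists u; split=> //.
by rewrite /=; lia.
Qed.

(** Division by [n] recovers [i] and [j] from the cell [i * n + j], so the existentials in [input]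
    have only the intended witnesses. *)
Lemma tracks_input m : tracks [::] (input x m).
Proof.
split=> //; last by move=> q y; case: q.
  split=> // i j; congr nat_of_bool; apply/existsP/idP => [[i']|ij].
    case/existsP=> j' /andP[/eqP eq_ij ij'].
    have n_gt0 : 0 < n by apply: leq_ltn_trans (ltn_ord i).
    have -> : i = i'.
      apply/val_inj; have := congr1 (divn^~ n) eq_ij.
      by rewrite !divnMDl // !divn_small // !addn0.
    have -> // : j = j'.
    by apply/val_inj; have := congr1 (modn^~ n) eq_ij; rewrite !modnMDl !modn_small.
  by exists i; apply/existsP; exists j; rewrite eqxx.
by rewrite mod0n div0n.
Qed.

Lemma walk_finds_qpartition m :
  n < m * B -> finds_qpartition (walk_cmd B) (300 * n.+1 ^ 3) B x m.
Proof.
move=> lt_mB.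
have [t [s [ex_t le_t [p [tp size_p trk]]]]] :
    halts (walk_cmd B) (input x m) (300 * n.+1 ^ 3)
      (fun s => exists p, [/\ trail p, size p = n & tracks p s]).
  eapply halts_le.
    apply: (halts_while (n := n)
      (I := fun i s => exists p, [/\ trail p, size p = i & tracks p s])).
    - by exists [::]; split=> //; [split=> // -[] | apply: tracks_input].
    - move=> i s lt_in [p [tp size_p trk]]; subst i; split.
        by case: trk => -[s00 _] _ _ [s0 _ _] _; rewrite /= s00 s0 subn_gt0.
      apply: halts_post; first exact: halts_step tp trk lt_in.
      by move=> s' [u tu trk']; exists (rcons p u); rewrite size_rcons.
    - move=> s [p [_ size_p [[s00 _] _ _ [s0 _ _] _]]].
      by rewrite /= s00 s0 size_p subnn.
  by rewrite /= !expnS expn0; nia.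
have [up sp _] := tp.
have p_all v : v \in p.
  have /subset_cardP/(_ (subset_predT _)) -> // : #|p| = #|G|.
  by rewrite (card_uniqP up).
(* Positions on the path are at most [n], which is below [m * B]; labels that do not occur give
   empty classes. *)
have lt_c v : index v p %/ B < m.
  rewrite ltn_divLR //; apply: leq_ltn_trans lt_mB.
  by rewrite -size_p index_size.
exists t, s, [ffun v => Ordinal (lt_c v)]; split=> //; last first.
  by case: trk => _ _ lab _ _ i; rewrite ffunE lab.
move=> c; have -> : [set v | [ffun v => Ordinal (lt_c v)] v == c] = chunk B p c.
  by apply/setP=> v; rewrite !inE ffunE p_all -val_eqE.
by split; [apply: connected_set_chunk | apply: card_chunk_le].
Qed.
End Walk.

(** * Choice of the constants and conclusion for rectangular grids *)

Lemma rectangular_grid_chart (G : sgraph) :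
  rectangular_grid G -> exists a b phi, @chart G setT a b 0 phi.
Proof.
move=> [k [l [k_gt0 l_gt0 [f f_bij f_edge]]]].
have [phi ch] := @chart_box _ _ _ f f_bij f_edge 0 0 k l k_gt0 l_gt0 (leqnn k) (leqnn l).
exists k, l, phi; have -> // : [set: G] = box f 0 0 k l.
by apply/setP=> v; rewrite !inE !ltn_ord.
Qed.

Theorem proposition3 (R : realType) (B : nat) (hB : (1 <= B)%N) :
  partitionable rectangular_grid B (1%R : R).
Proof.
(* The error constant of [grid_improvements] is [c]; taking [s] large makes the relative error
   [c / s] smaller than [eps / 2]. *)
move=> eps eps_gt0; pose c := 4 * B + 2 * B ^ 3.
have [s s_gt0 c_lt] : exists2 s, 0 < s & ((2 * c)%:R < s%:R * eps)%R.
  exists (Num.bound ((2 * c)%:R / eps)%R).+1 => //.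
  rewrite -ltr_pdivrMr //; apply: lt_trans (archi_boundP _) _.
    by rewrite divr_ge0 ?ler0n ?ltW.
  by rewrite ltr_nat.
have Bs_gt0 : (0 < (s * s * B)%:R :> R)%R by rewrite ltr0n !muln_gt0 s_gt0.
have Blt G q : ((1 + eps) * #|G : sgraph|%:R / (1 * B%:R) < q%:R)%R ->
    ((1 + eps) * #|G|%:R < (q * B)%:R)%R.
  by rewrite mul1r ltr_pdivrMr ?ltr0n // -natrM.
(* At most [s * s] classes of size at most [B] touch a tile, which gives [K]. The surplus [eps * n]
   less the error leaves at least [eps * n / 2] to be covered by [#|S| * (s * s * B)], which gives
   [delta]. The threshold [s * s] is the one in [card_tiles]. *)
exists (s * s * B), (eps / (2 * (s * s * B)%:R))%R, (s * s); split.
- by rewrite divr_gt0 // mulr_gt0.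
- exists (walk_cmd B), 300, 3 => G q [gridG le_N /Blt lt_q] x x_bij.
  apply: (walk_finds_qpartition x_bij (rectangular_grid_chart gridG) hB).
  rewrite -(ltr_nat R); apply: le_lt_trans lt_q.
  by rewrite mulrDl mul1r lerDl mulr_ge0 // ltW.
move=> G q [[k [l [k_gt0 l_gt0 [f f_bij f_edge]]]] le_N /Blt lt_q] P partP cP.
have [S cS hS] := grid_improvements f_bij f_edge s_gt0 hB partP k_gt0 l_gt0 le_N.
rewrite cP in cS hS; exists S => //.
rewrite mulrAC ler_pdivrMr ?mulr_gt0 //.
have sR_gt0 : (0 < s%:R :> R)%R by rewrite ltr0n.
rewrite -(ler_pM2l sR_gt0).
have h1 := ler_wpM2l (ltW sR_gt0) (ltW lt_q).
have h2 := ler_wpM2r (ler0n R #|G|) (ltW c_lt).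
move: cS; rewrite -/c -(ler_nat R); move: h1 h2.
by rewrite !(natrD, natrM); lra.
Qed.
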